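(* Let $p\ge1$, $r_1\le\cdots\le r_p$ nonnegative integers, $\mathbf{r}_p=(r_1,\ldots,r_p)$, and define $\widetilde{B}_n(z;\mathbf{r}_p)=\sum_{k=0}^{n}{n+|\mathbf{r}_p|\brace k+|\mathbf{r}_p|}_{\mathbf{r}_p}z^k$. Then, for every integer $k\ge0$, $$\sum_{n\ge k}{n+|\mathbf{r}_p|\brace k+|\mathbf{r}_p|}_{\mathbf{r}_p}t^n=t^{k+|\mathbf{r}_{p-1}|}\left(\tfrac1t\right)^{\underline{r_1}}\cdots\left(\tfrac1t\right)^{\underline{r_{p-1}}}\prod_{j=0}^{k+|\mathbf{r}_{p-1}|}\big(1-(r_p+j)t\big)^{-1},$$ and $$\sum_{n\ge0}\widetilde{B}_n(z;\mathbf{r}_p)t^n=\left(\tfrac1t\right)^{\underline{r_1}}\cdots\left(\tfrac1t\right)^{\underline{r_{p-1}}}\sum_{k\ge|\mathbf{r}_{p-1}|}\frac{z^{k-|\mathbf{r}_{p-1}|}t^k}{\prod_{j=0}^{k}\big(1-(r_p+j)t\big)}.$$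
   Context: $|\mathbf{r}_p|=r_1+\cdots+r_p$, $|\mathbf{r}_{p-1}|=r_1+\cdots+r_{p-1}$; $x^{\underline{r}}=x(x-1)\cdots(x-r+1)$ (falling factorial, $x^{\underline 0}=1$). With $R_1=\{1,\ldots,r_1\}$, $R_2=\{r_1+1,\ldots,r_1+r_2\}$, ..., $R_p$ the next $r_p$ integers, ${N\brace k}_{\mathbf{r}_p}$ is the number of partitions of $\{1,\ldots,N\}$ into $k$ nonempty blocks such that for each $i$ the elements of $R_i$ lie in distinct blocks. *)

(* Defs.v *)
From HB Require Import structures.
From mathcomp Require Import all_boot all_order all_algebra.
From mathcomp Require Import boolp classical_sets.

Set Implicit Arguments.
Unset Strict Implicit.
Unset Printing Implicit Defensive.

Import GRing.Theory.
Local Open Scope ring_scope.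

(* Formal power series R[[t]] are sequences of coefficients
   with the Cauchy product.  For an integral domain R, the identities that
   involve 1/t are stated in {fraction fps R}, the field of fractions of
   R[[t]], which contains the Laurent series ring R((t)) = R[[t]][1/t].      *)

Record fps (R : Type) := Fps { fps_coef :> nat -> R }.

HB.instance Definition _ (R : Type) := gen_eqMixin (fps R).
HB.instance Definition _ (R : Type) := gen_choiceMixin (fps R).

Lemma fpsP (R : Type) (f g : fps R) : (forall n, f n = g n) <-> f = g.
Proof.
split=> [|-> //]; case: f g => [f] [g] /= fg.
by congr Fps; apply: funext.
Qed.

Section FpsRing.
Variable R : comNzRingType.
Implicit Types f g h : fps R.

Definition fps_zero : fps R := Fps (fun=> 0).
Definition fps_add f g : fps R := Fps (fun n => f n + g n).
Definition fps_opp f : fps R := Fps (fun n => - f n).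

Fact fps_addA : associative fps_add.
Proof. by move=> f g h; apply/fpsP => n /=; rewrite addrA. Qed.
Fact fps_addC : commutative fps_add.
Proof. by move=> f g; apply/fpsP => n /=; rewrite addrC. Qed.
Fact fps_add0 : left_id fps_zero fps_add.
Proof. by move=> f; apply/fpsP => n /=; rewrite add0r. Qed.
Fact fps_addN : left_inverse fps_zero fps_opp fps_add.
Proof. by move=> f; apply/fpsP => n /=; rewrite addNr. Qed.

HB.instance Definition _ :=
  GRing.isZmodule.Build (fps R) fps_addA fps_addC fps_add0 fps_addN.

Definition fps_const (c : R) : fps R := Fps (fun n => if n == 0%N then c else 0).
Definition fps_mul f g : fps R :=
  Fps (fun n => \sum_(i < n.+1) f i * g (n - i)%N).

Definition fps_trunc m f : {poly R} := \poly_(i < m.+1) f i.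

Lemma coef_fps_trunc m f i : (i <= m)%N -> (fps_trunc m f)`_i = f i.
Proof. by move=> im; rewrite coef_poly ltnS im. Qed.

Lemma fps_mul_trunc m f g n :
  (n <= m)%N -> fps_mul f g n = (fps_trunc m f * fps_trunc m g)`_n.
Proof.
move=> nm; rewrite coefM; apply: eq_bigr => i _.
rewrite !coef_fps_trunc //; first by rewrite (leq_trans _ nm) // leq_subr.
by rewrite (leq_trans _ nm) // -ltnS.
Qed.

Fact fps_mulA : associative fps_mul.
Proof.
move=> f g h; apply/fpsP => n.
transitivity (fps_trunc n f * (fps_trunc n g * fps_trunc n h))`_n.
  rewrite coefM; apply: eq_bigr => i _.
  rewrite (@fps_mul_trunc n) ?leq_subr //.
  by rewrite coef_fps_trunc // -ltnS.
rewrite mulrA coefM; apply: eq_bigr => i _.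
by rewrite -(@fps_mul_trunc n) ?coef_fps_trunc ?leq_subr // -ltnS.
Qed.

Fact fps_mulC : commutative fps_mul.
Proof.
by move=> f g; apply/fpsP => n; rewrite !(@fps_mul_trunc n) // mulrC.
Qed.

Fact fps_mul1 : left_id (fps_const 1) fps_mul.
Proof.
move=> f; apply/fpsP => n /=; rewrite big_ord_recl /= mul1r subn0.
by rewrite big1 ?addr0 // => i _; rewrite mul0r.
Qed.

Fact fps_mulDl : left_distributive fps_mul fps_add.
Proof.
move=> f g h; apply/fpsP => n /=; rewrite -big_split /=.
by apply: eq_bigr => i _; rewrite mulrDl.
Qed.

Fact fps_1neq0 : fps_const 1 != fps_zero.
Proof.
by apply/eqP => /fpsP/(_ 0%N) /= /eqP; rewrite oner_eq0.
Qed.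

HB.instance Definition _ := GRing.Zmodule_isComNzRing.Build (fps R)
  fps_mulA fps_mulC fps_mul1 fps_mulDl fps_1neq0.

Definition fps_scale (c : R) f : fps R := Fps (fun n => c * f n).

Fact fps_scaleA a b f : fps_scale a (fps_scale b f) = fps_scale (a * b) f.
Proof. by apply/fpsP => n /=; rewrite mulrA. Qed.
Fact fps_scale1 : left_id 1 fps_scale.
Proof. by move=> f; apply/fpsP => n /=; rewrite mul1r. Qed.
Fact fps_scaleDr : right_distributive fps_scale +%R.
Proof. by move=> a f g; apply/fpsP => n /=; rewrite mulrDr. Qed.
Fact fps_scaleDl f : {morph fps_scale^~ f : a b / a + b}.
Proof. by move=> a b; apply/fpsP => n /=; rewrite mulrDl. Qed.

HB.instance Definition _ := GRing.Zmodule_isLmodule.Build R (fps R)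
  fps_scaleA fps_scale1 fps_scaleDr fps_scaleDl.

Definition fpsX : fps R := Fps (fun n => (n == 1%N)%:R).

Lemma fps_coef0 n : (0 : fps R) n = 0. Proof. by []. Qed.
Lemma fps_coef1 n : (1 : fps R) n = (n == 0%N)%:R.
Proof. by rewrite /GRing.one /=; case: n. Qed.
Lemma fps_coefD f g n : (f + g) n = f n + g n. Proof. by []. Qed.
Lemma fps_coefN f n : (- f) n = - f n. Proof. by []. Qed.
Lemma fps_coefM f g n : (f * g) n = \sum_(i < n.+1) f i * g (n - i)%N.
Proof. by []. Qed.
Lemma fps_coefZ c f n : (c *: f) n = c * f n. Proof. by []. Qed.

Lemma fps_coef_sum (I : Type) (s : seq I) (P : pred I) (F : I -> fps R) n :
  (\sum_(i <- s | P i) F i) n = \sum_(i <- s | P i) F i n.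
Proof. by elim/big_rec2: _ => // i x y _ <-. Qed.

Lemma fps_coefXM f n : (fpsX * f) n = if n is n'.+1 then f n' else 0.
Proof.
rewrite fps_coefM; case: n => [|n].
  by rewrite big_ord_recl big_ord0 /= mul0r addr0.
rewrite big_ord_recl /= mul0r add0r big_ord_recl /= mul1r subSS subn0.
by rewrite big1 ?addr0 // => i _; rewrite mul0r.
Qed.

Lemma fps_coefXn k n : (fpsX ^+ k) n = (n == k)%:R.
Proof.
elim: k n => [|k IH] n; first by rewrite expr0 fps_coef1.
by rewrite exprS fps_coefXM; case: n => [|n] //; rewrite IH eqSS.
Qed.

End FpsRing.

Section FpsDomain.
Variable R : idomainType.
Implicit Types f g h : fps R.

Definition fps_unit : {pred fps R} := [pred f | `[< exists g, g * f = 1 >]].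
(* The default value f (for f not invertible) follows the library's
   convention for x^-1. *)
Definition fps_inv f : fps R := xget f [set g | g * f = 1].

Fact fps_mulV : {in fps_unit, left_inverse 1 fps_inv *%R}.
Proof. by move=> f /asboolP[g gf]; rewrite /fps_inv; case: xgetP => // /(_ g). Qed.
Fact fps_unitP f g : g * f = 1 -> fps_unit f.
Proof. by move=> gf; apply/asboolP; exists g. Qed.
Fact fps_inv_out : {in [predC fps_unit], fps_inv =1 id}.
Proof.
move=> f /asboolP nu; rewrite /fps_inv; case: xgetP => // g _ gf.
by case: nu; exists g.
Qed.

HB.instance Definition _ := GRing.ComNzRing_hasMulInverse.Build (fps R)
  fps_mulV fps_unitP fps_inv_out.

Fact fps_idomain f g : f * g = 0 -> (f == 0) || (g == 0).
Proof.
move=> fg0; apply: contraT; rewrite negb_or => /andP[f0 g0].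
have ex h : h != 0 -> exists n, h n != 0.
  move=> h0; apply: contrapT => nh; case/eqP: h0; apply/fpsP => n.
  by apply: contrapT => /eqP hn; apply: nh; exists n.
have [i fi imin] := ex_minnP (ex _ f0); have [j gj jmin] := ex_minnP (ex _ g0).
have lt_i u : (u < i)%N -> f u = 0.
  by move=> ui; apply/eqP; apply: contraTT ui => /imin; rewrite -leqNgt.
have lt_j u : (u < j)%N -> g u = 0.
  by move=> uj; apply/eqP; apply: contraTT uj => /jmin; rewrite -leqNgt.
have ij : (i < (i + j).+1)%N by rewrite ltnS leq_addr.
have /fpsP/(_ (i + j)%N) := fg0; rewrite fps_coefM fps_coef0.
rewrite (bigD1 (Ordinal ij)) //= addKn big1 ?addr0 => [|u /eqP ui].
  by move/eqP; rewrite mulf_eq0 (negPf fi) (negPf gj).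
have [ltui|leiu] := ltnP u i; first by rewrite lt_i ?mul0r.
rewrite [g _]lt_j ?mulr0 // ltn_subLR; last by rewrite -ltnS.
rewrite ltn_add2r ltn_neqAle leiu andbT; apply/eqP => iu.
by apply: ui; apply: val_inj.
Qed.

HB.instance Definition _ :=
  GRing.ComUnitRing_isIntegral.Build (fps R) fps_idomain.

(* The first n coefficients of f^-1, when f 0 is invertible. *)
Fixpoint fps_inv_seq f (n : nat) : seq R :=
  if n is m.+1 then
    let s := fps_inv_seq f m in
    rcons s ((f 0%N)^-1 * ((m == 0%N)%:R - \sum_(i < m) s`_i * f (m - i)%N))
  else [::].

Lemma fps_unitE f : (f \is a GRing.unit) = (f 0%N \is a GRing.unit).
Proof.
apply/idP/idP => [fu|fu].
  have /fpsP/(_ 0%N) := mulVr fu.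
  rewrite fps_coefM big_ord_recl big_ord0 addr0 fps_coef1 /= => gf.
  by apply/unitrPr; exists (f^-1 0%N); rewrite mulrC.
have szs m : size (fps_inv_seq f m) = m by elim: m => //= m IH; rewrite size_rcons IH.
pose g := Fps (fun n => (fps_inv_seq f n.+1)`_n).
have nths m i : (i < m)%N -> (fps_inv_seq f m)`_i = g i.
  elim: m => // m IH; rewrite ltnS leq_eqVlt => /orP[/eqP -> //|im].
  by rewrite /= nth_rcons szs im IH.
apply/unitrPr; exists g; rewrite mulrC; apply/fpsP => n.
rewrite fps_coefM fps_coef1 big_ord_recr /= subnn nth_rcons szs ltnn eqxx.
rewrite mulrC mulrA divrr // mul1r.
rewrite [X in X + _](eq_bigr (fun i : 'I_n => g i * f (n - i)%N)) //.
rewrite [X in _ - X](eq_bigr (fun i : 'I_n => g i * f (n - i)%N)) => [|i _].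
  by rewrite addrC subrK.
by rewrite nths.
Qed.

End FpsDomain.

Section FpsSum.
Variable R : comNzRingType.

(* S is the t-adic limit of the partial sums of \sum_(k >= m) F k: each
   coefficient is eventually constant. *)
Definition fps_sums_to (m : nat) (F : nat -> fps R) (S : fps R) : Prop :=
  forall n, exists N, forall M, (N <= M)%N -> (\sum_(m <= k < M) F k) n = S n.

Definition fps_sum (m : nat) (F : nat -> fps R) : fps R :=
  xget 0 [set S | fps_sums_to m F S].

Lemma fps_sums_to_unique m F S S' :
  fps_sums_to m F S -> fps_sums_to m F S' -> S = S'.
Proof.
move=> FS FS'; apply/fpsP => n; have [N HN] := FS n; have [N' HN'] := FS' n.
by rewrite -(HN (maxn N N')) ?leq_maxl // HN' ?leq_maxr.
Qed.

Lemma fps_sumE m F S : fps_sums_to m F S -> fps_sum m F = S.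
Proof.
move=> FS; rewrite /fps_sum; case: xgetP => [S' _ FS'|/(_ S)//].
exact: fps_sums_to_unique FS' FS.
Qed.

Lemma fps_sums_to_order m (F : nat -> fps R) :
  (forall k n, (n < k)%N -> F k n = 0) ->
  fps_sums_to m F (Fps (fun n => \sum_(m <= k < n.+1) F k n)).
Proof.
move=> F0 n; exists (maxn m n.+1) => M; rewrite geq_max => /andP[mM nM] /=.
rewrite fps_coef_sum; have [mn|nm] := leqP m n.+1.
  rewrite (@big_cat_nat _ _ _ n.+1) //= [X in _ + X]big_nat.
  rewrite [X in _ + X]big1 ?addr0 // => k /andP[nk _].
  exact: F0.
rewrite [RHS]big_geq; last exact: ltnW.
rewrite big_nat big1 // => k /andP[mk _].
exact/F0/(leq_trans (ltnW nm)).
Qed.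

Lemma fps_sum_gen m (a : nat -> R) :
  fps_sum m (fun n => a n *: fpsX R ^+ n)
  = Fps (fun n => if (m <= n)%N then a n else 0).
Proof.
apply: fps_sumE; have /fps_sums_to_order-/(_ m) :
    forall k n, (n < k)%N -> (a k *: fpsX R ^+ k) n = 0.
  by move=> k n nk; rewrite fps_coefZ fps_coefXn ltn_eqF // mulr0.
congr fps_sums_to; apply/fpsP => n /=; case: leqP => [mn|nm]; last by rewrite big_geq.
rewrite big_nat_recr //= fps_coefXn eqxx mulr1 big_nat.
rewrite big1 ?add0r //.
by move=> k /andP[_ kn]; rewrite fps_coefXn gtn_eqF // mulr0.
Qed.

End FpsSum.

Notation "x %:F" := (@FracField.tofrac _ x) : ring_scope.

Definition falling (A : nzRingType) (x : A) (r : nat) : A :=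
  \prod_(0 <= j < r) (x - j%:R).

(* A vector (r_1, ..., r_p) is given by r : nat -> nat, of which only the
   values r 1, ..., r p are used. *)
Definition rsum (r : nat -> nat) (q : nat) : nat := (\sum_(1 <= i < q.+1) r i)%N.

(* The set {1, ..., N} is represented by 'I_N, i.e. shifted by one, so that
   R_i consists of the x with r_1 + ... + r_(i-1) <= x < r_1 + ... + r_i. *)
Definition Rset (r : nat -> nat) (N i : nat) : {set 'I_N} :=
  [set x : 'I_N | (rsum r i.-1 <= x < rsum r i)%N].

Definition rseparating (p : nat) (r : nat -> nat) (N : nat)
    (P : {set {set 'I_N}}) : bool :=
  all (fun i => [forall x in Rset r N i, forall y in Rset r N i,
                   (x != y) ==> (finset.pblock P x != finset.pblock P y)])
      (index_iota 1 p.+1).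

Definition rstirling (p : nat) (r : nat -> nat) (N k : nat) : nat :=
  #|[set P : {set {set 'I_N}} |
      [&& finset.partition P [set: 'I_N], #|P| == k & rseparating p r P]]|.

Definition rBell (R : comNzRingType) (p : nat) (r : nat -> nat) (n : nat)
    (z : R) : R :=
  \sum_(0 <= k < n.+1) (rstirling p r (n + rsum r p) (k + rsum r p))%:R * z ^+ k.

(* Main.v *)
(* Build the partitions of {1, ..., N} one element at a time: an element that
   clashes with a earlier ones, themselves pairwise clashing, turns the counts f
   (by number of blocks) into k |-> f (k - 1) + (k - a) f k.  These operators
   E_a = E_0 - a commute, so the counts for N = n + |r_p| are
     prod_(i < p) prod_(j < r_i) (E_0 - j)  E_0^n  prod_(j < r_p) (E_0 - j)
   applied to the indicator of 0, and the last product alone gives the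
   indicator of r_p.  In the generating function over n, the powers of E_0
   give t^(k - r_p) / prod_(r_p <= j <= k) (1 - j t), and every further factor
   E_0 - j acts as multiplication by 1/t - j. *)
Require Import Defs.
From mathcomp Require Import all_boot all_order all_algebra.
From mathcomp Require Import ring.
From mathcomp Require boolp.
Import GRing.Theory.
Local Open Scope ring_scope.

(** * Partitions of a finite vertex set into stable sets, and the effect of adding a vertex *)

Section StablePartitions.
Variables (T : finType) (e : rel T).
Implicit Types (A B C D : {set T}) (P Q : {set {set T}}) (k : nat).
Local Open Scope nat_scope.

Definition stable (B : {set T}) : bool :=
  [forall u in B, forall v in B, ~~ e u v].

(** Stated for an arbitrary relation and an arbitrary domain, so that elements can be inserted one
    by one while the type stays fixed. *)
Definition stable_partitions (D : {set T}) (k : nat) : {set {set {set T}}} :=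
  [set P | [&& partition P D, #|P| == k & [forall B in P, stable B]]].

Lemma stableP B : reflect {in B &, forall u v : T, ~~ e u v} (stable B).
Proof.
apply: (iffP forall_inP) => H u.
  by move=> v uB; move/forall_inP: (H u uB); apply.
by move=> uB; apply/forall_inP => v vB; apply: H.
Qed.

Lemma stable_partitions0 D : #|stable_partitions D 0| = (D == set0).
Proof.
have [->|D0] := eqVneq D set0.
  rewrite (_ : stable_partitions _ _ = [set set0]) ?cards1 //.
  apply/setP => P; rewrite !inE partition_set0 cards_eq0 andbA andbb.
  by case: eqP => // ->; apply/forall_inP => B; rewrite inE.
apply/eqP; rewrite cards_eq0; apply/eqP/setP => P; rewrite !inE.
apply/negP => /and3P[/cover_partition PD /eqP/cards0_eq P0 _].
by rewrite -PD P0 /cover big_set0 eqxx in D0.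
Qed.

Lemma stable_partitions_set0S k : #|stable_partitions set0 k.+1| = 0.
Proof.
apply/eqP; rewrite cards_eq0; apply/eqP/setP => P; rewrite !inE partition_set0.
by case: eqP => // ->; rewrite cards0.
Qed.

(** Removing the block [C] is a bijection, with inverse [h]: a partition of [D :\: C] cannot contain
    the nonempty set [C]. *)
Lemma card_stable_partitions_block D C k :
  C \subset D -> C != set0 -> stable C ->
  #|[set P in stable_partitions D k.+1 | C \in P]|
  = #|stable_partitions (D :\: C) k|.
Proof.
move=> CD C0 stC; pose h (Q : {set {set T}}) := C |: Q.
have CQ Q : Q \in stable_partitions (D :\: C) k -> C \notin Q.
  rewrite inE => /and3P[partQ _ _]; apply: contra C0 => CQ.
  have /subsetP CDC := partitionS partQ CQ.
  apply/eqP/setP => u; rewrite inE; apply/negP => uC.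
  by have := CDC u uC; rewrite inE uC.
have inj : {in stable_partitions (D :\: C) k &, injective h}.
  by move=> Q Q' /CQ nQ /CQ nQ' /(congr1 (fun X => X :\ C)); rewrite /h !setU1K.
rewrite -(card_in_imset inj); congr #|pred_of_set _|; apply/setP => P.
apply/idP/imsetP => [|[Q QP ->]]; last first.
  have nCQ := CQ Q QP; move: QP; rewrite !inE eqxx andbT => /and3P[partQ /eqP cQ stQ].
  have dCD : [disjoint C & D :\: C].
    by rewrite disjoint_sym disjoints_subset subDset setUCr subsetT.
  have := partitionU1 partQ C0 dCD.
  have -> : C :|: D :\: C = D.
    by apply/setP => u; rewrite !inE; case: (boolP (u \in C)) => //= /(subsetP CD).
  move=> -> /=; rewrite cardsU1 nCQ cQ eqxx /=; apply/forall_inP => B.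
  rewrite !inE => /orP[/eqP -> //|].
  by move/forall_inP: stQ; apply.
rewrite !inE => /andP[/and3P[partP /eqP cP /forall_inP stP] CP].
exists (P :\ C); last by rewrite /h setD1K.
rewrite inE partitionD1 //=; apply/andP; split; last first.
  by apply/forall_inP => B; rewrite !inE => /andP[_]; apply: stP.
by move: cP; rewrite (cardsD1 C) CP add1n => -[->].
Qed.

Lemma sum_card_stable_blocks (phi : pred {set T}) D k :
  \sum_(P in stable_partitions D k.+1) #|[set B in P | phi B]|
  = \sum_(C : {set T} | [&& C \subset D, C != set0, stable C & phi C])
      #|stable_partitions (D :\: C) k|.
Proof.
transitivity (\sum_(P in stable_partitions D k.+1)
    \sum_(C : {set T} | [&& C \subset D, C != set0, stable C & phi C]) (C \in P : nat)).
  apply: eq_bigr => P; rewrite inE => /and3P[partP _ /forall_inP stP].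
  rewrite -sum1_card big_mkcond [RHS]big_mkcond /=; apply: eq_bigr => B _.
  rewrite !inE; case BP: (B \in P) => /=; last by rewrite if_same.
  by rewrite (partitionS partP BP) (partition_neq0 partP BP) stP.
rewrite exchange_big /=; apply: eq_bigr => C /and4P[CD C0 stC _].
rewrite -card_stable_partitions_block // -sum1_card.
rewrite big_mkcond [RHS]big_mkcond; apply: eq_bigr => P _ /=.
by rewrite [in RHS]inE; case: ifP => //= _; case: ifP.
Qed.

(* By sum_card_stable_blocks, choosing the block x |: C of x in a partition of
   x |: D and choosing a block C that may receive x in a partition of D give
   the same sum over C, except that C may be empty in the former; of the k.+1
   blocks of a partition of D, exactly #|A| may not receive x. *)
Lemma card_stable_partitionsS D x A k :
  symmetric e -> irreflexive e -> x \notin D ->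
  A = [set u in D | e u x] -> {in A &, forall u v, u != v -> e u v} ->
  #|stable_partitions (x |: D) k.+1| + #|A| * #|stable_partitions D k.+1|
  = #|stable_partitions D k| + k.+1 * #|stable_partitions D k.+1|.
Proof.
move=> esym eirr xD defA cliqueA.
(* A stable block accepts [x] exactly when it avoids the neighbours of [x]. *)
have stU1 B : B \subset D -> stable (x |: B) = stable B && [disjoint A & B].
  move=> /subsetP BD; apply/stableP/andP => [st|[/stableP st dis] u v].
    split; first by apply/stableP => u v uB vB; apply: st; rewrite !inE ?uB ?vB orbT.
    rewrite disjoint_subset; apply/subsetP => u; rewrite defA !inE => /andP[_ eux].
    by apply: contraL eux => uB; apply: st; rewrite !inE ?uB ?eqxx ?orbT.
  have exB w : w \in B -> ~~ e w x.
    move=> wB; apply: contraTN dis => ewx; apply/pred0Pn; exists w.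
    by rewrite /= defA inE ewx (BD w wB) wB.
  rewrite !inE => /orP[/eqP -> | uB] /orP[/eqP -> | vB].
  - by rewrite eirr.
  - by rewrite esym exB.
  - by rewrite exB.
  - exact: st.
have cardA P : P \in stable_partitions D k.+1 ->
    #|[set B in P | stable (x |: B)]| + #|A| = k.+1.
  rewrite inE => /and3P[partP /eqP <- /forall_inP stP].
  have /and3P[/eqP covP tiP _] := partP.
  have AD u : u \in A -> u \in cover P by rewrite covP defA inE => /andP[].
  (* Two elements of the clique [A] cannot share a stable block, so [A] meets exactly [#|A|]
     blocks. *)
  have inj : {in A &, injective (pblock P)}.
    move=> u v uA vA /eqP; rewrite eq_pblock ?AD // => vu.
    apply: contraTeq isT => uv; apply: contraTN (cliqueA u v uA vA uv) => _.
    have /stableP := stP _ (pblock_mem (AD u uA)); apply=> //.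
    by rewrite mem_pblock AD.
  (* The blocks accepting [x] and the blocks meeting [A] are disjoint families with union [P]. *)
  rewrite -(card_in_imset inj) -cardsUI [X in _ + X](_ : _ = 0) ?addn0.
    congr #|pred_of_set _|; apply/setP => B; rewrite !inE.
    apply/orP/idP => [[/andP[]//|/imsetP[u uA ->]]|BP]; first exact/pblock_mem/AD.
    rewrite BP stU1 ?(partitionS partP) // stP //=.
    case: (boolP [disjoint A & B]) => [_|]; first by left.
    rewrite -setI_eq0 => /set0Pn[u]; rewrite inE => /andP[uA uB]; right.
    by apply/imsetP; exists u => //; rewrite (def_pblock tiP BP uB).
  apply/eqP; rewrite cards_eq0; apply/eqP/setP => B; rewrite !inE; apply/negP.
  move=> /andP[/andP[BP st] /imsetP[u uA defB]]; move: st.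
  rewrite stU1 ?(partitionS partP) // => /andP[_ /pred0P/(_ u)] /=.
  by rewrite uA defB mem_pblock AD.
have -> : #|stable_partitions (x |: D) k.+1| =
    #|stable_partitions D k|
    + \sum_(P in stable_partitions D k.+1) #|[set B in P | stable (x |: B)]|.
  (* Exactly one block of each partition contains [x], so every summand is 1 and the double count
     applies. *)
  transitivity (\sum_(P in stable_partitions (x |: D) k.+1)
      #|[set B in P | x \in B]|).
    rewrite -sum1_card; apply: eq_bigr => P; rewrite inE => /and3P[partP _ _].
    have /and3P[/eqP covP tiP _] := partP.
    have xP : x \in cover P by rewrite covP setU11.
    rewrite (_ : [set _ in _ | _] = [set pblock P x]) ?cards1 //.
    apply/setP => B; rewrite !inE; apply/andP/eqP => [[BP xB]|->].
      by rewrite (def_pblock tiP BP xB).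
    by rewrite pblock_mem // mem_pblock.
  rewrite !sum_card_stable_blocks.
  transitivity (\sum_(C : {set T} | (C \subset D) && stable (x |: C))
      #|stable_partitions (D :\: C) k|).
    rewrite (reindex_onto (fun C => x |: C) (fun B => B :\ x)) /=; last first.
      by move=> B /and4P[_ _ _ xB]; rewrite setD1K.
    apply: eq_big => [C|C /andP[_ /eqP defC]]; last first.
      have xC : x \notin C by rewrite -defC !inE eqxx.
      congr #|pred_of_set (stable_partitions _ k)|; apply/setP => u; rewrite !inE.
      by case: eqVneq => [->|//]; rewrite (negPf xD) andbF.
    have -> : x |: C != set0 by apply/set0Pn; exists x; rewrite setU11.
    rewrite setU11 andbT.
    rewrite andTb; case: (boolP (x \in C)) => xC.
      rewrite [C \subset D](contraNF _ xD) ?andFb; last by move/subsetP; apply.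
      apply/negbTE; apply/nandP; right; apply: contraTneq xC => <-.
      by rewrite !inE eqxx.
    rewrite setU1K // eqxx andbT subUset sub1set setU11 /=; congr (_ && _).
    by rewrite -[in RHS](setU1K xD) subsetD1 xC andbT.
  (* The term [C = set0] is the case where [x] is alone in its block; it contributes
     [#|stable_partitions D k|]. *)
  rewrite (bigD1 set0) /=; last first.
    rewrite sub0set setU0; apply/stableP => u v; rewrite !inE => /eqP -> /eqP ->.
    by rewrite eirr.
  rewrite setD0; congr (_ + _); apply: eq_bigl => C.
  case CD: (C \subset D) => //=; rewrite stU1 // andbC.
  by case: (C != set0); case: (stable C).
rewrite -addnA; congr (_ + _).
rewrite -[in RHS]sum1_card -[X in #|A| * X]sum1_card !big_distrr -big_split /=.
by apply: eq_bigr => P PD; rewrite !muln1 cardA.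
Qed.
End StablePartitions.

(** * The clash graph of the sets R_i: a disjoint union of cliques and isolated vertices *)

Section RSeparating.
Variables (p : nat) (r : nat -> nat).
Local Open Scope nat_scope.

Definition rclash (N : nat) : rel 'I_N := fun u v =>
  (u != v) && has (fun i => (u \in Rset r N i) && (v \in Rset r N i))
                  (index_iota 1 p.+1).

(** Separating every R_i means that no block contains two clashing elements, that is, all blocks are
    stable. *)
Lemma rstirlingE N k :
  rstirling p r N k = #|stable_partitions 'I_N (rclash N) [set: 'I_N] k|.
Proof.
congr #|pred_of_set _|; apply/setP => P; rewrite !inE.
case partP: (partition P _) => //=; case: eqP => //= _.
have /and3P[/eqP covP tiP _] := partP.
have inP u : u \in cover P by rewrite covP inE.
apply/allP/forall_inP => [sepP B BP|stP i ip].
  apply/stableP => u v uB vB; apply/negP => /andP[uv /hasP[i ip /andP[ui vi]]].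
  have /forall_inP/(_ u ui)/forall_inP/(_ v vi) := sepP i ip.
  by rewrite uv (def_pblock tiP BP uB) (def_pblock tiP BP vB) eqxx.
apply/forall_inP => u ui; apply/forall_inP => v vi; apply/implyP => uv.
rewrite eq_pblock //; apply/negP => vB.
have /stableP/(_ u v) := stP _ (pblock_mem (inP u)).
rewrite mem_pblock inP => /(_ isT vB); rewrite /rclash uv /= => /hasPn/(_ i ip).
by rewrite ui vi.
Qed.

Lemma rsumS q : rsum r q.+1 = rsum r q + r q.+1.
Proof. by rewrite /rsum big_nat_recr. Qed.

Lemma rsum_mono : {homo rsum r : q q' / q <= q'}.
Proof.
by apply: homo_leq => [//|a b c ab|q]; [exact: leq_trans|rewrite rsumS leq_addr].
Qed.

(** The R_i are consecutive intervals cut out by the nondecreasing partial sums, hence pairwise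
    disjoint. *)
Lemma Rset_index_unique N i i' (u : 'I_N) :
  u \in Rset r N i -> u \in Rset r N i' -> i = i'.
Proof.
wlog ii' : i i' / i < i' => [H ui ui'|].
  by case: (ltngtP i i') => [lt|lt|//]; [exact: H|apply/esym/H].
case: i' ii' => // i' ii'; rewrite !inE => /andP[_ ui] /andP[i'u _].
have ii1 : i <= i' by rewrite -ltnS.
by have := leq_trans ui (leq_trans (rsum_mono _ _ ii1) i'u); rewrite ltnn.
Qed.

Lemma card_ord_itv N a b : b <= N -> #|[set u : 'I_N | a <= u < b]| = b - a.
Proof.
move=> bN; rewrite -sum1dep_card.
rewrite -(big_mkord (fun i => a <= i < b) (fun=> 1)).
rewrite -(big_nat_widen _ _ _ _ _ bN) -[RHS]muln1 -sum_nat_const_nat.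
by rewrite (big_nat_widenl a 0).
Qed.

Definition ord_below N m : {set 'I_N} := [set u : 'I_N | u < m].

Lemma rclash_sym N : symmetric (rclash N).
Proof.
move=> u v; rewrite /rclash eq_sym; congr (_ && _).
by apply: eq_has => i; rewrite andbC.
Qed.

Lemma rclash_irr N : irreflexive (rclash N).
Proof. by move=> u; rewrite /rclash eqxx. Qed.

(** Since [x] lies in only one R_i, both clashes take place in that same set. This supplies the
    clique condition of [card_stable_partitionsS]. *)
Lemma rclash_clique N (x u v : 'I_N) :
  rclash N u x -> rclash N v x -> u != v -> rclash N u v.
Proof.
move=> /andP[_ /hasP[i ip /andP[ui xi]]] /andP[_ /hasP[i' _ /andP[vi' xi']]] uv.
rewrite /rclash uv; apply/hasP; exists i => //; rewrite ui.
by rewrite (Rset_index_unique _ _ _ _ xi xi').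
Qed.

(** The set [A] of the insertion step for the element [m]; its cardinality is the parameter of the
    operator applied at that step. *)
Definition earlier_clashes N m (mN : m < N) : {set 'I_N} :=
  [set u in ord_below N m | rclash N u (Ordinal mN)].

Lemma card_stable_ord_belowS N m (mN : m < N) k :
  #|stable_partitions 'I_N (rclash N) (ord_below N m.+1) k.+1|
    + #|earlier_clashes N m mN|
      * #|stable_partitions 'I_N (rclash N) (ord_below N m) k.+1|
  = #|stable_partitions 'I_N (rclash N) (ord_below N m) k|
    + k.+1 * #|stable_partitions 'I_N (rclash N) (ord_below N m) k.+1|.
Proof.
have -> : ord_below N m.+1 = Ordinal mN |: ord_below N m.
  by apply/setP => u; rewrite !inE ltnS leq_eqVlt.
apply: (card_stable_partitionsS _ _ _ (Ordinal mN)) => //.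
- exact: rclash_sym.
- exact: rclash_irr.
- by rewrite inE ltnn.
- move=> u v; rewrite !inE => /andP[_ ux] /andP[_ vx].
  by apply: rclash_clique ux vx.
Qed.

(** The element at offset [j] in R_(q+1) clashes, among the earlier elements, with exactly the [j]
    that precede it in this interval. *)
Lemma card_earlier_clashes_block N q j (qjN : rsum r q + j < N) :
  q < p -> j < r q.+1 -> #|earlier_clashes N _ qjN| = j.
Proof.
move=> qp jr; rewrite -[RHS](addKn (rsum r q)) -(card_ord_itv N) ?(ltnW qjN) //.
have xq : Ordinal qjN \in Rset r N q.+1 by rewrite inE /= rsumS leq_addr ltn_add2l.
congr #|pred_of_set _|; apply/setP => u; rewrite !inE; apply/andP/andP.
  move=> [ux /andP[_ /hasP[i _ /andP[ui xi]]]]; split=> //.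
  by move: ui; rewrite (Rset_index_unique _ _ _ _ xi xq) inE => /andP[].
move=> [qu ux]; split=> //; apply/andP; split.
  by apply: contraTneq ux => ->; rewrite ltnn.
apply/hasP; exists q.+1; first by rewrite mem_index_iota.
by rewrite xq inE qu rsumS /= andbT (ltn_trans ux) // ltn_add2l.
Qed.

(** An element at or beyond position |r_p|, counting from 0, lies in no R_i. *)
Lemma card_earlier_clashes_free N m (mN : m < N) :
  rsum r p <= m -> #|earlier_clashes N _ mN| = 0.
Proof.
move=> pm; apply/eqP; rewrite cards_eq0; apply/eqP/setP => u; rewrite !inE.
apply/negP => /andP[_ /andP[_ /hasP[i ip /andP[_ xi]]]].
move: ip xi; rewrite mem_index_iota inE /= ltnS => /andP[_ ip] /andP[_ mi].
by have := leq_trans mi (leq_trans (rsum_mono _ _ ip) pm); rewrite ltnn.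
Qed.

End RSeparating.

(** * Commuting operators on sequences of counts, and their generating functions *)

Section StirlingOperators.
Variable R : comNzRingType.
Implicit Types (f : nat -> R) (s t : seq nat).

(** Ring-valued, so that [k - a] is a true difference and the operators commute even where
    [k < a]. *)
Definition stirling_op (a : nat) f : nat -> R :=
  fun k => (if k is k'.+1 then f k' else 0) + (k%:R - a%:R) * f k.

Definition stirling_ops s f : nat -> R := foldr stirling_op f s.

Definition delta (m : nat) : nat -> R := fun k => (k == m)%:R.

Lemma stirling_opC a b f :
  stirling_op a (stirling_op b f) = stirling_op b (stirling_op a f).
Proof. by apply: boolp.funext => -[|[|k]]; rewrite /stirling_op; ring. Qed.

Lemma stirling_ops_cat s t f :
  stirling_ops (s ++ t) f = stirling_ops s (stirling_ops t f).
Proof. exact: foldr_cat. Qed.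

Lemma stirling_ops_swap s t f :
  stirling_ops s (stirling_ops t f) = stirling_ops t (stirling_ops s f).
Proof.
have swap1 a u g : stirling_op a (stirling_ops u g) = stirling_ops u (stirling_op a g).
  by elim: u => //= b u IH; rewrite stirling_opC IH.
by elim: s => //= a s ->; rewrite swap1.
Qed.

Lemma stirling_ops_perm s t f :
  perm_eq s t -> stirling_ops s f = stirling_ops t f.
Proof.
move=> st; pattern t; apply: (catCA_perm_ind _ st) => //.
move=> s1 s2 s3 ->; rewrite !stirling_ops_cat.
by rewrite stirling_ops_swap.
Qed.

(** The operator with parameter [m] shifts [delta m] to [delta m.+1], because its factor [k - m]
    vanishes at the only point of the support. *)
Lemma stirling_ops_iota m : stirling_ops (iota 0 m) (delta 0) = delta m.
Proof.
elim: m => // m IH; rewrite -addn1 iotaD stirling_ops_cat stirling_ops_swap IH /=.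
apply: boolp.funext => k; rewrite /stirling_op /delta addn1 add0n.
have -> : (k%:R - m%:R) * (k == m)%:R = 0 :> R.
  by case: eqP => [->|_]; rewrite ?subrr ?mul0r ?mulr0.
by case: k => [|k]; rewrite addr0.
Qed.

(** Each operator extends the support upwards by at most one. *)
Lemma stirling_ops_high m s k : (m + size s < k)%N -> stirling_ops s (delta m) k = 0.
Proof.
elim: s k => [|a s IH] k /=; first by rewrite addn0 /delta => /gtn_eqF ->.
case: k => // k; rewrite addnS ltnS => mk; rewrite /stirling_op !IH ?mulr0 ?addr0 //.
exact: ltnW.
Qed.

Lemma stirling_ops_low m s k : (k < m)%N -> stirling_ops s (delta m) k = 0.
Proof.
elim: s k => [|a s IH] k /= km; first by rewrite /delta ltn_eqF.
by rewrite /stirling_op IH // mulr0 addr0; case: k km => // k /ltnW /IH.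
Qed.

(** Generating function in the number [n] of free elements; [m] will be r_p, with the word of the
    last set already absorbed in [delta m]. *)
Definition stirling_gf s (m k : nat) : fps R :=
  Fps (fun n => stirling_ops (s ++ nseq n 0%N) (delta m) k).

Lemma fps_coef_natM (c : nat) (g : fps R) n : (c%:R * g) n = c%:R * g n.
Proof.
rewrite !mulr_natl; elim: c => [|c IH]; first by rewrite !mulr0n.
by rewrite !mulrSr fps_coefD IH.
Qed.

Lemma fps_coef_oneBXM (c : nat) (g : fps R) n :
  ((1 - c%:R * fpsX R) * g) n = g n - (if n is n'.+1 then c%:R * g n' else 0).
Proof.
rewrite mulrBl mul1r fps_coefD fps_coefN -mulrA fps_coef_natM fps_coefXM.
by case: n => //; rewrite mulr0.
Qed.

(** This is multiplication by 1/t - a with t cleared: prepending 0 to the word shifts the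
    coefficients, that is, divides by t. The bound on [k] makes the constant term on the right
    vanish. *)
Lemma stirling_gf_cons a s m k : (m + size s < k)%N ->
  fpsX R * stirling_gf (a :: s) m k = (1 - a%:R * fpsX R) * stirling_gf s m k.
Proof.
move=> mk; apply/fpsP => -[|n]; rewrite fps_coefXM fps_coef_oneBXM /=.
  by rewrite cats0 stirling_ops_high // subr0.
rewrite (stirling_ops_perm (s ++ 0%N :: _) (0%N :: s ++ nseq n 0%N)); last first.
  by rewrite perm_catC /= perm_cons perm_catC.
by rewrite /= /stirling_op; ring.
Qed.

Lemma stirling_gf_reduce s m k : (m + size s <= k)%N ->
  fpsX R ^+ size s * stirling_gf s m k
  = (\prod_(j <- s) (1 - j%:R * fpsX R)) * stirling_gf [::] m k.
Proof.
elim: s => [|a s IH] mk; first by rewrite big_nil expr0.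
rewrite /= addnS in mk; rewrite big_cons exprSr -!mulrA stirling_gf_cons //.
by rewrite mulrCA IH ?(ltnW mk).
Qed.

(** The recurrence of the operator with parameter 0 gives (1 - (m+d+1)t) G_(d+1) = t G_d, where G_d
    is the series for index [m + d]. *)
Lemma stirling_gf_nil m d :
  (\prod_(0 <= j < d.+1) (1 - (m + j)%:R * fpsX R)) * stirling_gf [::] m (m + d)
  = fpsX R ^+ d.
Proof.
elim: d => [|d IH].
  rewrite big_nat1 addn0 expr0; apply/fpsP => n.
  rewrite fps_coef_oneBXM fps_coef1 /=; case: n => [|n] /=.
    by rewrite /delta eqxx subr0.
  (* The remaining term has index just below [m], outside the support. *)
  rewrite /stirling_op subr0 addrK; case: m => // m.
  exact: stirling_ops_low.
rewrite big_nat_recr //= -mulrA exprS -IH [RHS]mulrCA; congr (_ * _).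
apply/fpsP => -[|n]; rewrite fps_coefXM fps_coef_oneBXM /=.
  by rewrite /delta -[X in _ == X]addn0 eqn_add2l subr0.
by rewrite addnS /stirling_op subr0 addrK.
Qed.

(** * The r-Stirling numbers as words of operators *)

Variables (p : nat) (r : nat -> nat).

(** The roots, with multiplicity, of the product of the falling factorials of orders r_1, ...,
    r_q. *)
Definition falling_roots (q : nat) : seq nat :=
  flatten [seq iota 0 (r i) | i <- index_iota 1 q.+1].

Lemma falling_rootsS q : falling_roots q.+1 = falling_roots q ++ iota 0 (r q.+1).
Proof.
rewrite /falling_roots /index_iota !subn1 !succnK -(addn1 q) iotaD map_cat flatten_cat.
by rewrite /= cats0 add1n addn1.
Qed.

Lemma size_falling_roots q : size (falling_roots q) = rsum r q.
Proof.
elim: q => [|q IH]; first by rewrite /rsum big_geq.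
by rewrite falling_rootsS size_cat IH size_iota rsumS.
Qed.

Lemma stable_seqS N m (mN : (m < N)%N) :
  (fun k => #|stable_partitions 'I_N (rclash p r N) (ord_below N m.+1) k|%:R)
  = stirling_op #|earlier_clashes p r N m mN|
      (fun k => #|stable_partitions 'I_N (rclash p r N) (ord_below N m) k|%:R).
Proof.
apply: boolp.funext => -[|k]; rewrite /stirling_op.
  rewrite !stable_partitions0 add0r.
  have -> : ord_below N m.+1 == set0 = false.
    by apply/negbTE/set0Pn; exists (Ordinal mN); rewrite inE /=.
  (* At [k = 0] the factor is minus the number of clashes, which is 0 when there is no earlier
     element. *)
  case: eqP => [D0|_]; last by rewrite mulr0.
  rewrite (_ : #|_| = 0%N) ?subrr ?mul0r //.
  apply/eqP; rewrite cards_eq0; apply/eqP/setP => u.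
  by rewrite inE D0 inE.
have /(congr1 (fun x => x%:R : R)) := card_stable_ord_belowS p r N m mN k.
rewrite !natrD !natrM => /(canRL (addrK _)) ->; ring.
Qed.

Lemma stable_seq_roots N q : (q <= p)%N -> (rsum r q <= N)%N ->
  (fun k =>
     #|stable_partitions 'I_N (rclash p r N) (ord_below N (rsum r q)) k|%:R)
  = stirling_ops (falling_roots q) (delta 0).
Proof.
elim: q => [|q IH] qp qN.
  apply: boolp.funext => k; rewrite /rsum big_geq //=.
  rewrite (_ : ord_below N 0 = set0); last by apply/setP => u; rewrite !inE.
  case: k => [|k]; first by rewrite stable_partitions0 eqxx.
  by rewrite stable_partitions_set0S.
rewrite falling_rootsS.
(* Inner induction on the elements of R_(q+1): inserted in order, they contribute the parameters 0,
   1, 2, and so on. *)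
have step j : (j <= r q.+1)%N ->
    (fun k =>
       #|stable_partitions 'I_N (rclash p r N) (ord_below N (rsum r q + j)) k|%:R)
    = stirling_ops (falling_roots q ++ iota 0 j) (delta 0).
  elim: j => [|j IHj] jr.
    by rewrite addn0 cats0 IH ?(ltnW qp) // (leq_trans _ qN) // rsumS leq_addr.
  have jN : (rsum r q + j < N)%N by rewrite (leq_trans _ qN) // rsumS -addnS leq_add2l.
  rewrite addnS (stable_seqS _ _ jN) (card_earlier_clashes_block _ _ _ _ _ jN) //.
  rewrite IHj ?(ltnW jr) // -addn1 iotaD add0n catA.
  rewrite [RHS](stirling_ops_perm _ (j :: falling_roots q ++ iota 0 j)) //.
  by rewrite perm_catC.
by rewrite rsumS step.
Qed.

Lemma rstirling_ops n k :
  (rstirling p r (n + rsum r p) k)%:R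
  = stirling_ops (falling_roots p ++ nseq n 0%N) (delta 0) k.
Proof.
rewrite rstirlingE; set N := (n + rsum r p)%N.
have -> : [set: 'I_N] = ord_below N (rsum r p + n).
  by apply/setP => u; rewrite !inE addnC ltn_ord.
have : (rsum r p + n <= N)%N by rewrite addnC.
(* [N] is kept fixed, since the ground type depends on it; only the number [m] of inserted free
   elements varies. *)
move: (n) => m; move: k; suff H : (rsum r p + m <= N)%N ->
  (fun k =>
     #|stable_partitions 'I_N (rclash p r N) (ord_below N (rsum r p + m)) k|%:R)
  = stirling_ops (falling_roots p ++ nseq m 0%N) (delta 0).
  by move=> k /H /(congr1 (fun h => h k)).
elim: m => [|m IH] mN; first by rewrite addn0 cats0 stable_seq_roots // leq_addl.
rewrite addnS in mN *; rewrite (stable_seqS _ _ mN).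
rewrite card_earlier_clashes_free ?leq_addr // IH ?(ltnW mN) //.
rewrite [RHS](stirling_ops_perm _ (0%N :: falling_roots p ++ nseq m 0%N)) //.
by rewrite perm_catC /= perm_cons perm_catC.
Qed.

End StirlingOperators.

(** * The generating function of the r-Stirling numbers, inside the power series ring *)

Lemma rstirling_gf (R : comNzRingType) (q : nat) (r : nat -> nat) (k : nat) :
  Fps (fun n =>
    (rstirling q.+1 r (n + rsum r q.+1) (k + rsum r q.+1))%:R)
  = stirling_gf R (falling_roots r q) (r q.+1) (k + rsum r q.+1).
Proof.
(* By commutation the word of the last set acts first and turns [delta 0] into [delta (r q.+1)]. *)
apply/fpsP => n /=; rewrite rstirling_ops falling_rootsS -(stirling_ops_iota R (r q.+1)).
by rewrite !stirling_ops_cat [stirling_ops _ (iota _ _) _]stirling_ops_swap.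
Qed.

Lemma prod_oneBXM_unit (R : idomainType) (c : nat -> nat) (s : seq nat) :
  \prod_(j <- s) (1 - (c j)%:R * fpsX R) \is a GRing.unit.
Proof.
apply: rpred_prod => j _.
have := fps_coef_oneBXM R (c j) 1 0; rewrite mulr1 fps_unitE => ->.
by rewrite subr0 fps_coef1 unitr1.
Qed.

(** The first identity with its negative powers of t cleared. The index is
    [r q.+1 + (k + rsum r q)], so [stirling_gf_nil] applies with [d = k + rsum r q]. *)
Lemma rstirling_gfE (R : idomainType) (q : nat) (r : nat -> nat) (k : nat) :
  fpsX R ^+ rsum r q
    * Fps (fun n =>
        (rstirling q.+1 r (n + rsum r q.+1) (k + rsum r q.+1))%:R)
  = (\prod_(j <- falling_roots r q) (1 - j%:R * fpsX R))
    * (fpsX R ^+ (k + rsum r q)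
       / \prod_(0 <= j < (k + rsum r q).+1) (1 - (r q.+1 + j)%:R * fpsX R)).
Proof.
rewrite rstirling_gf -{1}size_falling_roots stirling_gf_reduce; last first.
  by rewrite size_falling_roots rsumS addnC leq_addl.
congr (_ * _); rewrite -(stirling_gf_nil R (r q.+1)).
rewrite [X in stirling_gf _ _ _ X](_ : _ = r q.+1 + (k + rsum r q))%N.
  by rewrite mulrAC divrr ?mul1r // prod_oneBXM_unit.
by rewrite rsumS addnA addnC.
Qed.

(** * Compatibility of t-adic sums with products and reindexing *)

Section FpsSums.
Variable R : comNzRingType.

Lemma fps_coefXnM_lt k n (g : fps R) : (n < k)%N -> (fpsX R ^+ k * g) n = 0.
Proof.
move=> nk; rewrite fps_coefM big1 // => i _.
by rewrite fps_coefXn ltn_eqF ?mul0r // (leq_ltn_trans _ nk) // -ltnS.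
Qed.

Lemma fps_scale_mull (c : R) (f g : fps R) : c *: f * g = c *: (f * g).
Proof.
apply/fpsP => n; rewrite fps_coefZ !fps_coefM big_distrr.
by apply: eq_bigr => i _; exact: esym (mulrA _ _ _).
Qed.

Lemma fps_scale_mulr (c : R) (f g : fps R) : f * (c *: g) = c *: (f * g).
Proof. by rewrite mulrC fps_scale_mull mulrC. Qed.

Lemma fps_sums_toM m (F : nat -> fps R) (S g : fps R) :
  fps_sums_to m F S -> fps_sums_to m (fun k => g * F k) (g * S).
Proof.
move=> FS n.
(* A coefficient of a product involves only finitely many coefficients of each factor, so one
   threshold serves them all. *)
have [N HN] : exists N, forall i, (i <= n)%N -> forall M, (N <= M)%N ->
    (\sum_(m <= k < M) F k) i = S i.
  elim: n => [|n [N HN]]; first by have [N HN] := FS 0%N; exists N => -[].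
  have [N' HN'] := FS n.+1; exists (maxn N N') => i.
  rewrite leq_eqVlt => /orP[/eqP ->|].
    by move=> M; rewrite geq_max => /andP[_ /HN'].
  by rewrite ltnS => /HN HNi M; rewrite geq_max => /andP[/HNi].
exists N => M NM; rewrite -big_distrr !fps_coefM.
by apply: eq_bigr => i _; rewrite HN // leq_subr.
Qed.

Lemma fps_sums_to_shift m (F : nat -> fps R) (S : fps R) :
  fps_sums_to m F S -> fps_sums_to 0 (fun k => F (k + m)%N) S.
Proof.
move=> FS n; have [N HN] := FS n; exists N => M NM.
by rewrite -(HN (M + m)%N) ?(leq_trans NM) ?leq_addr // -{2}[m]add0n big_addn addnK.
Qed.

End FpsSums.

(** * Falling factorials of 1/t in the fraction field *)

Section FractionForm.
Variable R : idomainType.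
Notation X := ((fpsX R)%:F).

Lemma fpsX_frac_neq0 : X != 0.
Proof.
rewrite tofrac_eq0; apply/eqP => /fpsP/(_ 1%N) /eqP.
by rewrite /= oner_eq0.
Qed.

(** Each factor t (1/t - j) equals 1 - j t. *)
Lemma falling_invX n :
  X ^+ n * falling X^-1 n = (\prod_(j <- iota 0 n) (1 - j%:R * fpsX R))%:F.
Proof.
rewrite /falling rmorph_prod /= -{1}[n]subn0 -prodr_const_nat -big_split /=.
rewrite /index_iota subn0.
apply: eq_bigr => j _; rewrite rmorphB rmorph1 rmorphM rmorph_nat /=.
by rewrite mulrBr divff ?fpsX_frac_neq0 // mulrC.
Qed.

Lemma prod_falling_invX (r : nat -> nat) q :
  X ^+ rsum r q * \prod_(1 <= i < q.+1) falling X^-1 (r i)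
  = (\prod_(j <- falling_roots r q) (1 - j%:R * fpsX R))%:F.
Proof.
elim: q => [|q IH]; first by rewrite /rsum !big_geq // expr0 mulr1 big_nil rmorph1.
rewrite falling_rootsS big_cat tofracM -IH -falling_invX rsumS exprD.
by rewrite big_nat_recr //= mulrACA.
Qed.

End FractionForm.

(** * Both identities, by cancelling a power of t in the fraction field *)

Theorem theorem7 (R : idomainType) (z : R) (p : nat) (r : nat -> nat)
    (p_ge1 : (1 <= p)%N)
    (r_sorted : forall i j : nat,
       (1 <= i)%N -> (i <= j)%N -> (j <= p)%N -> (r i <= r j)%N) :
  (forall k : nat,
     (fps_sum k (fun n =>
        (rstirling p r (n + rsum r p) (k + rsum r p))%:R *: fpsX R ^+ n))%:F
     = (fpsX R)%:F ^+ (k + rsum r p.-1)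
       * \prod_(1 <= i < p) falling ((fpsX R)%:F)^-1 (r i)
       * \prod_(0 <= j < (k + rsum r p.-1).+1)
           (1 - (r p + j)%:R * (fpsX R)%:F)^-1)
  /\
  (fps_sum 0 (fun n => rBell p r n z *: fpsX R ^+ n))%:F
  = \prod_(1 <= i < p) falling ((fpsX R)%:F)^-1 (r i)
    * (fps_sum (rsum r p.-1) (fun k =>
         (z ^+ (k - rsum r p.-1)%N *: fpsX R ^+ k)
         / \prod_(0 <= j < k.+1) (1 - (r p + j)%:R * fpsX R)))%:F.
Proof.
case: p p_ge1 r_sorted => // q _ _; rewrite [q.+1.-1]/=.
pose Phi k := Fps (fun n =>
  (rstirling q.+1 r (n + rsum r q.+1) (k + rsum r q.+1))%:R : R).
pose Pi := \prod_(j <- falling_roots r q) (1 - j%:R * fpsX R).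
pose W k := fpsX R ^+ k / \prod_(0 <= j < k.+1) (1 - (r q.+1 + j)%:R * fpsX R).
(* Fewer than [k + rsum r q.+1] operators act on [delta 0]. Hence [Phi k] has order at least [k],
   and starting the sum at [n = k] loses nothing. *)
have Phi0 k n : (n < k)%N -> Phi k n = 0.
  move=> nk; rewrite /= rstirling_ops stirling_ops_high //.
  by rewrite size_cat size_nseq size_falling_roots add0n addnC ltn_add2r.
have X0 := fpsX_frac_neq0 R.
have XPhi k : fpsX R ^+ rsum r q * Phi k = Pi * W (k + rsum r q)%N.
  exact: rstirling_gfE.
have XPhiF k :
    (fpsX R)%:F ^+ rsum r q * (Phi k)%:F = Pi%:F * (W (k + rsum r q)%N)%:F.
  by rewrite -tofracM -XPhi tofracM tofracXn.
split=> [k|].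
  rewrite fps_sum_gen (_ : Fps _ = Phi k); last first.
    by apply/fpsP => n /=; case: leqP => // /Phi0 <-.
  (* This nonzero power of t absorbs the negative powers in the falling factorials, which become
     [Pi]. *)
  apply: (mulfI (expf_neq0 (rsum r q) X0)).
  rewrite XPhiF /Pi -prod_falling_invX -!mulrA; congr (_ * _).
  rewrite [RHS]mulrCA; congr (_ * _).
  rewrite /W tofracM tofracXn; congr (_ * _).
  rewrite rmorphV ?prod_oneBXM_unit // rmorph_prod prodfV /=; congr (_^-1).
  by apply: eq_bigr => j _; rewrite rmorphB rmorph1 rmorphM rmorph_nat.
set F := (F in fps_sum (rsum r q) F).
have FE k : F k = z ^+ (k - rsum r q) *: W k by rewrite /F /W fps_scale_mull.
have F0 k n : (n < k)%N -> F k n = 0.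
  by move=> nk; rewrite FE fps_coefZ fps_coefXnM_lt ?mulr0.
have sumF := fps_sums_to_order (rsum r q) F0.
(* Exchange of summations: since [Phi k] has order at least [k], only [k <= n] contributes to the
   coefficient [n], as in the finite sum [rBell]. *)
have sumPhi : fps_sums_to 0 (fun k => z ^+ k *: Phi k)
    (Fps (fun n => rBell q.+1 r n z)).
  have := @fps_sums_to_order _ 0 (fun k => z ^+ k *: Phi k).
  set S := Fps _; have -> : S = Fps (fun n => rBell q.+1 r n z).
    by apply/fpsP => n; apply: eq_bigr => k _; rewrite mulrC.
  by apply=> k n nk; rewrite fps_coefZ Phi0 ?mulr0.
rewrite fps_sum_gen (fps_sumE sumF).
rewrite (_ : Fps _ = Fps (fun n => rBell q.+1 r n z)); last exact/fpsP.
apply: (mulfI (expf_neq0 (rsum r q) X0)).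
rewrite mulrA prod_falling_invX -tofracXn -!tofracM; congr (_%:F).
(* Both sides are now limits of series with equal terms, once the right one is shifted to start at
   0; uniqueness of limits concludes. *)
have sumL := fps_sums_toM _ _ _ _ (fpsX R ^+ rsum r q) sumPhi.
have sumR := fps_sums_to_shift _ _ _ _ (fps_sums_toM _ _ _ _ Pi sumF).
apply: (fps_sums_to_unique sumL); congr fps_sums_to: sumR.
by apply: boolp.funext => k; rewrite FE !fps_scale_mulr XPhi addnK.
Qed.
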